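(* Let $R$ be a ring and $\sigma$ an endomorphism of $R$ such that $\sigma(Re)\subseteq Re$ for every idempotent $e=e^2\in R$. Then: (1) If $R$ is left idempotent reflexive, then $R[x;\sigma]$ and $R[[x;\sigma]]$ are left idempotent reflexive. (2) If $R[x;\sigma]$ or $R[[x;\sigma]]$ is right idempotent reflexive, then $R$ is right idempotent reflexive.
   Context: Rings are associative with unity. A ring $S$ is called left idempotent reflexive if for all $a\in S$ and all idempotents $e=e^2\in S$, $eSa=0$ implies $aSe=0$. A ring $S$ is called right idempotent reflexive if for all $a\in S$ and all idempotents $e=e^2\in S$, $aSe=0$ implies $eSa=0$. For an endomorphism $\sigma$ of $R$, the skew polynomial ring $R[x;\sigma]$ is the set of polynomials $\sum_{i=0}^n a_ix^i$ with coefficients $a_i\in R$ written on the left, with usual addition and with multiplication determined by $xr=\sigma(r)x$ for all $r\in R$. The skew power series ring $R[[x;\sigma]]$ consists of all power series $\sum_{i=0}^\infty a_ix^i$ ($a_i\in R$), multiplied using the distributive law and the rule $xr=\sigma(r)x$ for all $r\in R$. *)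

(* Defs.v *)
From HB Require Import structures.
From mathcomp Require Import all_boot all_algebra.
From mathcomp Require Import boolp classical_sets.

Set Implicit Arguments.
Unset Strict Implicit.
Unset Printing Implicit Defensive.

Import GRing.Theory.
Local Open Scope ring_scope.

(* All rings are [pzRingType]s: associative and unital, with 1 = 0 allowed.  *)

Definition idempotent_elt (S : pzRingType) (e : S) : Prop := e * e = e.

Definition left_idempotent_reflexive (S : pzRingType) : Prop :=
  forall a e : S, idempotent_elt e ->
    (forall s : S, e * s * a = 0) -> (forall s : S, a * s * e = 0).

Definition right_idempotent_reflexive (S : pzRingType) : Prop :=
  forall a e : S, idempotent_elt e ->
    (forall s : S, a * s * e = 0) -> (forall s : S, e * s * a = 0).

Definition left_principal (S : pzRingType) (e : S) : set S :=
  [set r * e | r in [set: S]]%classic.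

(* A series \sum_i a_i x^i is its sequence of (left) coefficients; [sigma] is *)
(* a parameter of the type because the multiplication depends on it.         *)
Record skew_series (R : pzRingType) (sigma : {rmorphism R -> R}) : Type :=
  SkewSeries { scoef : nat -> R }.

Section SkewSeriesRing.
Variables (R : pzRingType) (sigma : {rmorphism R -> R}).
Local Notation series := (skew_series sigma).
Implicit Types (f g h : series) (a b r : R).

Lemma skew_seriesP f g : scoef f =1 scoef g -> f = g.
Proof. by case: f g => [u] [v] /= /funext->. Qed.

HB.instance Definition _ := gen_eqMixin series.
HB.instance Definition _ := gen_choiceMixin series.

Definition sseries_zero : series := SkewSeries sigma (fun=> 0).
Definition sseries_opp f : series := SkewSeries sigma (fun n => - scoef f n).
Definition sseries_add f g : series :=
  SkewSeries sigma (fun n => scoef f n + scoef g n).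

Fact sseries_addA : associative sseries_add.
Proof. by move=> f g h; apply: skew_seriesP => n /=; rewrite addrA. Qed.
Fact sseries_addC : commutative sseries_add.
Proof. by move=> f g; apply: skew_seriesP => n /=; rewrite addrC. Qed.
Fact sseries_add0 : left_id sseries_zero sseries_add.
Proof. by move=> f; apply: skew_seriesP => n /=; rewrite add0r. Qed.
Fact sseries_addN : left_inverse sseries_zero sseries_opp sseries_add.
Proof. by move=> f; apply: skew_seriesP => n /=; rewrite addNr. Qed.

HB.instance Definition _ := GRing.isZmodule.Build series
  sseries_addA sseries_addC sseries_add0 sseries_addN.

Lemma iter_rmorph0 i : iter i sigma 0 = 0.
Proof. by elim: i => //= i ->; rewrite rmorph0. Qed.
Lemma iter_rmorph1 i : iter i sigma 1 = 1.
Proof. by elim: i => //= i ->; rewrite rmorph1. Qed.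
Lemma iter_rmorphD i : {morph iter i sigma : a b / a + b}.
Proof. by move=> a b; elim: i => //= i ->; rewrite rmorphD. Qed.
Lemma iter_rmorphM i : {morph iter i sigma : a b / a * b}.
Proof. by move=> a b; elim: i => //= i ->; rewrite rmorphM. Qed.
Lemma iter_rmorph_sum i (m n : nat) (F : nat -> R) :
  iter i sigma (\sum_(m <= j < n) F j) = \sum_(m <= j < n) iter i sigma (F j).
Proof. exact: (big_morph _ (iter_rmorphD i) (iter_rmorph0 i)). Qed.

Definition sseries_one : series := SkewSeries sigma (fun n => (n == 0%N)%:R).

(* (a x^i) (b x^j) = a sigma^i(b) x^(i + j), by iterating x r = sigma(r) x.  *)
Definition sseries_mul f g : series := SkewSeries sigma (fun n =>
  \sum_(0 <= i < n.+1) scoef f i * iter i sigma (scoef g (n - i)%N)).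

Fact sseries_mulA : associative sseries_mul.
Proof.
move=> f g h; apply: skew_seriesP => n /=; symmetry.
under eq_bigr do rewrite big_distrl /=.
transitivity (\sum_(0 <= k < n.+1) \sum_(0 <= i < n.+1 | (i <= k)%N)
   scoef f i * iter i sigma (scoef g (k - i)) * iter k sigma (scoef h (n - k))).
  by apply: eq_big_nat => k /andP[_ lekn]; rewrite (big_nat_widen _ _ n.+1).
rewrite (exchange_big_dep_nat xpredT) //=.
apply: eq_big_nat => i /andP[_ lein].
rewrite iter_rmorph_sum big_distrr /= -(@big_nat_widenl _ _ _ i 0 _ xpredT) //.
rewrite -{1}(add0n i) big_addn subSn //; apply: eq_big_nat => j _.
by rewrite addnK iter_rmorphM mulrA -iterD addnC subnDA.
Qed.
Fact sseries_mul1l : left_id sseries_one sseries_mul.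
Proof.
move=> f; apply: skew_seriesP => n /=; rewrite big_nat_recl //= mul1r subn0.
by rewrite big1 ?addr0 // => i _; rewrite mul0r.
Qed.
Fact sseries_mul1r : right_id sseries_one sseries_mul.
Proof.
move=> f; apply: skew_seriesP => n /=; rewrite big_nat_recr //= subnn.
rewrite iter_rmorph1 mulr1 big_nat big1 ?add0r // => i /andP[_ ltin].
by rewrite subn_eq0 leqNgt ltin iter_rmorph0 mulr0.
Qed.
Fact sseries_mulDl : left_distributive sseries_mul +%R.
Proof.
move=> f g h; apply: skew_seriesP => n /=; rewrite -big_split /=.
by apply: eq_bigr => i _; rewrite mulrDl.
Qed.
Fact sseries_mulDr : right_distributive sseries_mul +%R.
Proof.
move=> f g h; apply: skew_seriesP => n /=; rewrite -big_split /=.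
by apply: eq_bigr => i _; rewrite iter_rmorphD mulrDr.
Qed.

HB.instance Definition _ := GRing.Zmodule_isPzRing.Build series
  sseries_mulA sseries_mul1l sseries_mul1r sseries_mulDl sseries_mulDr.

Lemma scoef0 n : scoef (0 : series) n = 0. Proof. by []. Qed.
Lemma scoef1 n : scoef (1 : series) n = (n == 0%N)%:R. Proof. by []. Qed.
Lemma scoefN f n : scoef (- f) n = - scoef f n. Proof. by []. Qed.
Lemma scoefD f g n : scoef (f + g) n = scoef f n + scoef g n.
Proof. by []. Qed.
Lemma scoefM f g n : scoef (f * g) n =
  \sum_(0 <= i < n.+1) scoef f i * iter i sigma (scoef g (n - i)%N).
Proof. by []. Qed.

Definition skewC r : series :=
  SkewSeries sigma (fun n => if n == 0%N then r else 0).
Definition skewX : series := SkewSeries sigma (fun n => (n == 1%N)%:R).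

Lemma scoefCM r f n : scoef (skewC r * f) n = r * scoef f n.
Proof.
rewrite scoefM big_nat_recl //= subn0.
by rewrite big1 ?addr0 // => i _; rewrite mul0r.
Qed.

Lemma scoefXM f n :
  scoef (skewX * f) n = if n is m.+1 then sigma (scoef f m) else 0.
Proof.
rewrite scoefM big_nat_recl //= mul0r add0r; case: n => [|n].
  by rewrite big_geq.
rewrite big_nat_recl //= mul1r subn1 /= big1 ?addr0 // => i _.
by rewrite mul0r.
Qed.

Lemma scoefXn m n : scoef (skewX ^+ m) n = (n == m)%:R.
Proof.
elim: m n => [|m IHm] n; first by rewrite expr0 scoef1.
by rewrite exprS scoefXM; case: n => [|n] //; rewrite IHm rmorph_nat.
Qed.

Lemma skewXC r : skewX * skewC r = skewC (sigma r) * skewX.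
Proof.
apply: skew_seriesP => n; rewrite scoefXM scoefCM.
by case: n => [|[|n]] /=; rewrite ?rmorph0 (mulr0, mulr1).
Qed.

(* R[x; sigma] is the subring of R[[x; sigma]] of the series with finitely   *)
(* many nonzero coefficients.                                                *)
Definition skew_finite : {pred series} :=
  fun f => `[< exists n : nat, forall i, (n <= i)%N -> scoef f i = 0 >].

Fact skew_finite_subring : subring_closed skew_finite.
Proof.
split=> [|f g /asboolP[m fm] /asboolP[n gn]|f g /asboolP[m fm] /asboolP[n gn]].
- by apply/asboolP; exists 1%N => -[].
- apply/asboolP; exists (maxn m n) => i; rewrite geq_max => /andP[mi ni].
  by rewrite scoefD scoefN fm // gn // subrr.
- apply/asboolP; exists (m + n)%N => k mnk; rewrite scoefM big1 // => i _.
  have [/fm->|ltim] := leqP m i; first by rewrite mul0r.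
  rewrite gn ?iter_rmorph0 ?mulr0 // leq_subRL.
    by apply: leq_trans mnk; rewrite leq_add2r ltnW.
  by apply: leq_trans (ltnW ltim) (leq_trans (leq_addr n m) mnk).
Qed.

Record skew_poly : Type := SkewPoly {
  skew_poly_val :> series;
  skew_poly_finite : skew_poly_val \in skew_finite
}.

HB.instance Definition _ := [isSub for skew_poly_val].
HB.instance Definition _ := [Choice of skew_poly by <:].
HB.instance Definition _ := GRing.SubChoice_isSubPzRing.Build
  series skew_finite skew_poly skew_finite_subring.

Lemma skewC_finite r : skewC r \in skew_finite.
Proof. by apply/asboolP; exists 1%N => -[]. Qed.
Lemma skewX_finite : skewX \in skew_finite.
Proof. by apply/asboolP; exists 2%N => -[|[]]. Qed.

Lemma skew_polyE (p : skew_poly) : exists n : nat,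
  p = \sum_(0 <= i < n) skewC (scoef p i) * skewX ^+ i :> series.
Proof.
case: p => f /= /asboolP[n fn]; exists n; apply: skew_seriesP => k.
rewrite (big_morph (fun g => scoef g k) (fun g h => scoefD g h k) (scoef0 k)).
under eq_bigr do rewrite scoefCM scoefXn mulr_natr mulrb eq_sym.
by rewrite -big_mkcond big_nat1_eq /=; case: ltnP => // /fn.
Qed.

End SkewSeriesRing.

(* Main.v *)
Require Import Defs.
From HB Require Import structures.
From mathcomp Require Import all_boot all_algebra.
From mathcomp Require Import boolp classical_sets.

(** The hypothesis on [sigma], applied to both [e] and [1 - e], forces
    [sigma e = e] for every idempotent [e] ([fixes_idempotents]). Everything
    else follows from this. Below, [S] is the ring of skew polynomials or of
    skew power series.

    Part (1). Let [E] be an idempotent of [S] with [E S f = 0], and let [e] be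
    its constant term, which is idempotent in [R]. Induction on the degree
    gives [e R f_n = 0] for all [n] ([constant_annihilates]), so [f_n R e = 0]
    because [R] is left idempotent reflexive. The ideal [R e R] is
    [sigma]-stable since [sigma e = e], and modulo it [E] is an idempotent
    series with zero constant term, hence zero. So every coefficient of [E]
    lies in [R e R] and is killed by [f_n R] ([annihilates_coefs]), which yields
    [f S E = 0]. The equations [E r f = 0] with [r] in [R], which make sense in
    both rings, are all that enters, so one argument serves polynomials and
    power series ([series_reflexive]).

    Part (2). If [a R e = 0], then [a r x^i e = a r sigma^i(e) x^i = a r e x^i]
    vanishes, so [a S e = 0]; right reflexivity of [S] gives [e S a = 0], and in
    particular [e R a = 0]. *)

Import GRing.Theory.
Local Open Scope ring_scope.
Local Open Scope classical_set_scope.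

Section SkewReflexive.
Variables (R : pzRingType) (sigma : {rmorphism R -> R}).
Local Notation series := (skew_series sigma).
Implicit Types (E f g : series) (a e r : R).

(** [sigma e = sigma e * e] because [sigma e] lies in [R e], and
    [sigma (1 - e) * e = 0] because [sigma (1 - e)] lies in [R (1 - e)]; the
    latter says [e = sigma e * e]. *)
Lemma fixes_idempotents :
  (forall e, idempotent_elt e ->
     [set sigma y | y in left_principal e] `<=` left_principal e) ->
  forall e, idempotent_elt e -> sigma e = e.
Proof.
move=> stab e ee.
have absorb c : idempotent_elt c -> sigma c * c = sigma c.
  move=> cc; have [|r _ <-] := stab c cc (sigma c); last by rewrite -mulrA cc.
  by exists c => //; exists 1; rewrite ?mul1r.
have ee' : idempotent_elt (1 - e).
  by rewrite /idempotent_elt mulrBr mulr1 mulrBl mul1r ee subrr subr0.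
have := absorb _ ee'; rewrite rmorphB rmorph1 mulrBr mulr1.
move/eqP; rewrite -subr_eq0 addrAC subrr add0r oppr_eq0 mulrBl mul1r.
by rewrite absorb // subr_eq0 => /eqP.
Qed.

Hypothesis fix_idem : forall e, idempotent_elt e -> sigma e = e.

Lemma iter_fixes_idempotents e i : idempotent_elt e -> iter i sigma e = e.
Proof. by move=> ee; elim: i => //= i ->; apply: fix_idem. Qed.

Lemma constant_idempotent E :
  E * E = E -> idempotent_elt (scoef E 0).
Proof.
by move=> EE; rewrite /idempotent_elt -{3}EE scoefM big_nat1.
Qed.

(** Inserting the constant [e r], rather than [r], between [E] and [f] is what
    isolates the top term: in degree [n] every term other than [e e r f_n] has
    a factor [sigma^i (e r f_(n - i))], zero by induction. *)
Lemma constant_annihilates E f :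
  E * E = E -> (forall r, E * skewC sigma r * f = 0) ->
  forall n r, scoef E 0 * r * scoef f n = 0.
Proof.
move=> /constant_idempotent ee Ef; elim/ltn_ind => n IHn r.
have /(congr1 (fun g => scoef g n)) := Ef (scoef E 0 * r).
rewrite scoef0 -mulrA scoefM; under eq_bigr do rewrite scoefCM.
rewrite big_nat_recl //= subn0 !mulrA ee.
rewrite big_nat big1 ?addr0 // => i /andP[_ lt_in].
by rewrite IHn ?iter_rmorph0 ?rmorph0 ?mulr0 // ltn_subrL (leq_trans _ lt_in).
Qed.

(** This is the inclusion of the coefficients of [E], and of their images under
    the powers of [sigma], in the ideal [R e R], phrased through annihilators so
    that no ideal has to be formed. In [E * E = E] the degree [k] coefficient is
    a sum of products whose left factor is an earlier coefficient, except for
    the last product, whose right factor is [sigma^k e = e]. *)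
Lemma annihilates_coefs E a :
  E * E = E -> (forall r, a * r * scoef E 0 = 0) ->
  forall k m r, a * r * iter m sigma (scoef E k) = 0.
Proof.
move=> EE ae; have ee := constant_idempotent _ EE.
elim/ltn_ind => k IHk m r.
rewrite -{1}EE scoefM iter_rmorph_sum big_distrr big_nat_recr //= subnn.
rewrite big_nat big1 => [|i /andP[_ lt_ik]].
  by rewrite add0r iter_rmorphM !(iter_fixes_idempotents (scoef E 0)) // mulrA
             -(mulrA a) ae.
by rewrite iter_rmorphM mulrA IHk ?mul0r.
Qed.

Lemma series_reflexive E f :
  left_idempotent_reflexive R -> E * E = E ->
  (forall r, E * skewC sigma r * f = 0) -> forall g, f * g * E = 0.
Proof.
move=> reflR EE Ef g; apply: skew_seriesP => n.
rewrite scoef0 -mulrA scoefM big1 // => i _.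
rewrite scoefM iter_rmorph_sum big_distrr big1 //= => j _.
rewrite iter_rmorphM -iterD mulrA; apply: annihilates_coefs => //.
apply: reflR; first exact: constant_idempotent.
exact: constant_annihilates.
Qed.

Lemma skewCM a r : skewC sigma a * skewC sigma r = skewC sigma (a * r).
Proof.
by apply: skew_seriesP => n; rewrite scoefCM /=; case: ifP; rewrite ?mulr0.
Qed.

Lemma constants_annihilate a e :
  idempotent_elt e -> (forall r, a * r * e = 0) ->
  forall g, skewC sigma a * g * skewC sigma e = 0.
Proof.
move=> ee ae g; apply: skew_seriesP => n.
rewrite scoef0 scoefM big1 // => i _; rewrite scoefCM /=.
by case: ifP => _; rewrite ?iter_rmorph0 ?mulr0 // iter_fixes_idempotents.
Qed.

Lemma left_reflexive_skew :
  left_idempotent_reflexive R ->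
  left_idempotent_reflexive (skew_poly sigma) /\
  left_idempotent_reflexive series.
Proof.
move=> reflR; split=> [f E EE Ef g | f E EE Ef g]; last first.
  exact: series_reflexive.
apply: val_inj; rewrite !rmorphM /=; apply: series_reflexive => // [|r].
  by rewrite -[in RHS]EE.
exact: (congr1 val (Ef (SkewPoly (skewC_finite sigma r)))).
Qed.

Lemma right_reflexive_base :
  right_idempotent_reflexive (skew_poly sigma) \/
  right_idempotent_reflexive series ->
  right_idempotent_reflexive R.
Proof.
move=> reflS a e ee ae s.
suff /(congr1 (fun g => scoef g 0)) :
  skewC sigma e * skewC sigma s * skewC sigma a = 0 by rewrite !skewCM.
have CeCe : skewC sigma e * skewC sigma e = skewC sigma e by rewrite skewCM ee.
have CaCe := constants_annihilate _ _ ee ae.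
case: reflS => [reflP | reflS]; last exact: reflS.
pose C r := SkewPoly (skewC_finite sigma r).
have := reflP (C a) (C e); move/(_ _ _ (C s))/(congr1 val); apply.
  exact: val_inj.
by move=> g; apply: val_inj; apply: CaCe.
Qed.

End SkewReflexive.

Theorem proposition2p1 (R : pzRingType) (sigma : {rmorphism R -> R})
    (sigma_Re : forall e : R, idempotent_elt e ->
      [set sigma y | y in left_principal e] `<=` left_principal e) :
  (left_idempotent_reflexive R ->
     left_idempotent_reflexive (skew_poly sigma) /\
     left_idempotent_reflexive (skew_series sigma)) /\
  (right_idempotent_reflexive (skew_poly sigma) \/
   right_idempotent_reflexive (skew_series sigma) ->
     right_idempotent_reflexive R).
Proof.
have fix_idem := fixes_idempotents R sigma sigma_Re.
by split; [apply: left_reflexive_skew | apply: right_reflexive_base].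
Qed.
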